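(* Let $f:\mathbb{R}^d\to\mathbb{R}$ be continuously differentiable and bounded below by $f^*\in\mathbb{R}$, and let $L$ be a local first-order smoothness oracle (LFSO) for $f$. Let $0<\eta<2$ and let $(x_k)_{k\ge 0}$, $(\widetilde{R}_k)_{k\ge0}$ be generated by Gradient Descent with LFSO from a starting point $x_0\in\mathbb{R}^d$ with stepsize factor $\eta$ and any choices $R_k>0$. Then either $\liminf_{k\to\infty}\|\nabla f(x_k)\|=0$ or $\lim_{k\to\infty}L(x_k,\widetilde{R}_k)=\infty$.
   Context: $\|\cdot\|$ is the Euclidean norm and $B(x,R)=\{y\in\mathbb{R}^d:\|y-x\|\le R\}$. For a continuously differentiable $f:\mathbb{R}^d\to\mathbb{R}$, a function $L:\mathbb{R}^d\times(0,\infty)\to[0,\infty)$ is a local first-order smoothness oracle (LFSO) for $f$ if (i) for all $x\in\mathbb{R}^d$, all $R>0$ and all $y\in B(x,R)$, $|f(y)-f(x)-\nabla f(x)^T(y-x)|\le \frac{L(x,R)}{2}\|y-x\|^2$; and (ii) $L$ is non-decreasing in $R$. Gradient Descent with LFSO: given $x_0\in\mathbb{R}^d$ and a stepsize factor $\eta>0$, for $k=0,1,2,\ldots$ choose any $R_k>0$, set $\widetilde{R}_k=\max\left\{R_k,\ \frac{\eta}{L(x_k,R_k)}\|\nabla f(x_k)\|\right\}$, and iterate $x_{k+1}=x_k-\frac{\eta}{L(x_k,\widetilde{R}_k)}\nabla f(x_k)$. It is understood that $L(x_k,R_k)>0$ for all $k$, so that the iteration is well defined. *)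

(* Defs.v *)
From HB Require Import structures.
From mathcomp Require Import all_boot all_order all_algebra.
From mathcomp Require Import all_classical all_reals all_analysis.

Set Implicit Arguments.
Unset Strict Implicit.
Unset Printing Implicit Defensive.

Import Order.TTheory GRing.Theory Num.Theory.
Import numFieldNormedType.Exports.

Local Open Scope classical_set_scope.
Local Open Scope ring_scope.

Definition edot (R : realType) (d : nat) (u v : 'rV[R]_d) : R :=
  \sum_(i < d) u 0 i * v 0 i.

(* The library norm `|u| on 'rV[R]_d is the max norm, hence a separate
   Euclidean norm; both induce the same topology, so the library's
   [differentiable] and [continuous] have their usual meaning on R^d. *)
Definition enorm (R : realType) (d : nat) (u : 'rV[R]_d) : R :=
  Num.sqrt (edot u u).

Definition eclosed_ball (R : realType) (d : nat) (x : 'rV[R]_d) (r : R) :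
  set 'rV[R]_d := [set y | enorm (y - x) <= r].

Definition grad (R : realType) (d : nat) (f : 'rV[R]_d -> R) (x : 'rV[R]_d) :
  'rV[R]_d := \row_(i < d) 'D_(delta_mx 0 i) f x.

Definition continuously_differentiable (R : realType) (d : nat)
  (f : 'rV[R]_d -> R) : Prop :=
  (forall x, differentiable f x) /\ continuous (grad f).

(* An oracle R^d * (0, oo) -> [0, oo) is a total function whose values at
   nonpositive radii are irrelevant. *)
Definition is_LFSO (R : realType) (d : nat) (f : 'rV[R]_d -> R)
  (L : 'rV[R]_d -> R -> R) : Prop :=
  [/\ forall x r, 0 < r -> 0 <= L x r,
      forall x r, 0 < r -> forall y, eclosed_ball x r y ->
        `|f y - f x - edot (grad f x) (y - x)|
          <= L x r / 2 * enorm (y - x) ^+ 2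
    & forall x r s, 0 < r -> r <= s -> L x r <= L x s].

Definition GD_with_LFSO (R : realType) (d : nat) (f : 'rV[R]_d -> R)
  (L : 'rV[R]_d -> R -> R) (eta : R) (x0 : 'rV[R]_d)
  (r rt : nat -> R) (x : nat -> 'rV[R]_d) : Prop :=
  x 0%N = x0 /\
  forall k : nat,
    [/\ 0 < r k,
        0 < L (x k) (r k),
        rt k = Num.max (r k) (eta / L (x k) (r k) * enorm (grad f (x k)))
      & x k.+1 = x k - (eta / L (x k) (rt k)) *: grad f (x k)].

(* Main.v *)
(** Since the step from x_k stays in the ball of radius rt_k, the oracle
    inequality gives f(x_k) - f(x_{k+1}) >= c |grad f(x_k)|^2 / L(x_k, rt_k)
    with c = eta (1 - eta/2) > 0.  The values f(x_k) decrease and are bounded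
    below, so the left-hand side tends to 0; if the gradients are eventually
    bounded away from 0, this forces L(x_k, rt_k) to tend to infinity. *)
Require Import Defs.
From mathcomp Require Import all_boot all_order all_algebra.
From mathcomp Require Import all_classical all_reals all_analysis.
From mathcomp Require Import ring lra.

Import Order.TTheory GRing.Theory Num.Theory.
Import numFieldNormedType.Exports.

Local Open Scope classical_set_scope.
Local Open Scope ring_scope.

Lemma edot_ge0 (R : realType) (d : nat) (u : 'rV[R]_d) : 0 <= edot u u.
Proof. by apply: sumr_ge0 => i _; rewrite -expr2 sqr_ge0. Qed.

Lemma sqr_enorm (R : realType) (d : nat) (u : 'rV[R]_d) :
  enorm u ^+ 2 = edot u u.
Proof. by rewrite sqr_sqrtr // edot_ge0. Qed.

Lemma edotZr (R : realType) (d : nat) (a : R) (u v : 'rV[R]_d) :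
  edot u (a *: v) = a * edot u v.
Proof.
by rewrite /edot mulr_sumr; apply: eq_bigr => i _; rewrite mxE mulrCA.
Qed.

Lemma enormZ (R : realType) (d : nat) (a : R) (u : 'rV[R]_d) :
  enorm (a *: u) = `|a| * enorm u.
Proof.
rewrite /enorm -sqrtr_sqr -sqrtrM ?sqr_ge0 //; congr Num.sqrt.
by rewrite /edot mulr_sumr; apply: eq_bigr => i _; rewrite mxE; ring.
Qed.

(** Since [L x] is non-decreasing and [r <= rt], the step taken with [L x rt] is no longer than the
    one with [L x r], whose length [rt] dominates through the max. Hence the oracle inequality at
    radius [rt] covers the new point. *)
Lemma LFSO_descent (R : realType) (d : nat) (f : 'rV[R]_d -> R)
    (L : 'rV[R]_d -> R -> R) (eta r rt : R) (x : 'rV[R]_d) :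
  is_LFSO f L -> 0 < eta -> 0 < r -> 0 < L x r ->
  rt = Num.max r (eta / L x r * enorm (grad f x)) ->
  0 < L x rt /\
  f (x - (eta / L x rt) *: grad f x)
    <= f x - eta * (1 - eta / 2) * enorm (grad f x) ^+ 2 / L x rt.
Proof.
move=> [_ Lf Lmono] eta0 r0 Lr0 rtE.
have rrt : r <= rt by rewrite rtE le_max lexx.
have rt0 : 0 < rt by exact: lt_le_trans rrt.
have Lle : L x r <= L x rt by exact: Lmono.
have Lrt0 : 0 < L x rt by exact: lt_le_trans Lle.
split=> //; set g := grad f x; set t := eta / L x rt.
have t0 : 0 < t by rewrite divr_gt0.
have step : x - t *: g - x = (- t) *: g by rewrite addrAC subrr add0r scaleNr.
have nstep : enorm (x - t *: g - x) = t * enorm g.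
  by rewrite step enormZ normrN gtr0_norm.
have ball : eclosed_ball x rt (x - t *: g).
  rewrite /eclosed_ball /= nstep.
  apply: (@le_trans _ _ (eta / L x r * enorm g)).
    by rewrite ler_wpM2r ?sqrtr_ge0 // ler_pM2l // lef_pV2 // posrE.
  by rewrite rtE le_max lexx orbT.
have := Lf x rt rt0 _ ball.
rewrite nstep step edotZr -sqr_enorm => /(le_trans (ler_norm _)).
(* The quadratic and linear terms both become multiples of [enorm g ^+ 2 / L x rt], with
   coefficients summing to [- eta * (1 - eta / 2)]. *)
have -> : L x rt / 2 * (t * enorm g) ^+ 2
          = eta ^+ 2 / 2 * (enorm g ^+ 2 / L x rt).
  by rewrite /t; field; rewrite gt_eqF.
have -> : - t * enorm g ^+ 2 = - eta * (enorm g ^+ 2 / L x rt).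
  by rewrite /t; ring.
by rewrite -mulrA; lra.
Qed.

(** The liminf is the limit of the tail infima, which are nonnegative here. If all of them vanished,
    so would the liminf; a positive one serves as [e]. *)
Lemma limn_einf_neq0_bound (R : realType) (u : nat -> R) :
  (forall n, 0 <= u n) -> limn_einf (EFin \o u) <> 0%E ->
  exists2 e : R, 0 < e & \forall n \near \oo, e <= u n.
Proof.
move=> u0 lim_neq0.
have einfs_ge0 n : (0 <= einfs (EFin \o u) n)%E.
  by apply: le_ereal_inf_tmp => _ [k _ <-]; rewrite lee_fin.
have [n einfs_n_gt0] : exists n, (0 < einfs (EFin \o u) n)%E.
  apply: contrapT => /forallNP einfs_le0; apply: lim_neq0.
  have -> : limn_einf (EFin \o u) = limn (einfs (EFin \o u)).
    by rewrite limn_einf_lim.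
  have -> : einfs (EFin \o u) = cst 0%E.
    apply/funext => n; apply/eqP; rewrite eq_le einfs_ge0 andbT leNgt.
    exact/negP.
  exact: lim_cst.
have einfs_le k : (n <= k)%N -> (einfs (EFin \o u) n <= (u k)%:E)%E.
  by move=> nk; apply: ereal_inf_lbound; exists k.
(* The tail infimum lies between 0 and [u n], so it is a real number. *)
have einfs_fin : einfs (EFin \o u) n \is a fin_num.
  by rewrite ge0_fin_numE // (le_lt_trans (einfs_le n _)) ?ltry.
exists (fine (einfs (EFin \o u) n)); first by rewrite -lte_fin fineK.
by exists n => // k /= nk; rewrite -lee_fin fineK // einfs_le.
Qed.

(** By monotone convergence [u] has a limit, which its shift shares. *)
Lemma nonincreasing_increment_cvg0 (R : realType) (u : nat -> R) (m : R) :
  (forall n, u n.+1 <= u n) -> (forall n, m <= u n) ->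
  u n - u n.+1 @[n --> \oo] --> 0.
Proof.
move=> u_noninc m_le.
have /cvg_ex[l ul] : cvgn u.
  apply: nonincreasing_is_cvgn; first exact/nonincreasing_seqP.
  by exists m => _ [n _ <-].
rewrite -(subrr l); apply: cvgB => //.
by rewrite (cvg_shiftS u).
Qed.

Theorem theorem3p3 (R : realType) (d : nat)
  (f : 'rV[R]_d -> R) (fstar : R) (L : 'rV[R]_d -> R -> R)
  (eta : R) (x0 : 'rV[R]_d) (r rt : nat -> R) (x : nat -> 'rV[R]_d) :
  continuously_differentiable f ->
  (forall y, fstar <= f y) ->
  is_LFSO f L ->
  0 < eta -> eta < 2 ->
  GD_with_LFSO f L eta x0 r rt x ->
  limn_einf (fun k => (enorm (grad f (x k)))%:E) = 0%E
  \/ L (x k) (rt k) @[k --> \oo] --> +oo.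
Proof.
move=> _ f_ge LF eta0 eta2 [_ GD].
have [|lim_neq0] := pselect
  (limn_einf (fun k => (enorm (grad f (x k)))%:E) = 0%E); first by left.
right.
have [e e0 g_ge] := limn_einf_neq0_bound _
  (fun k => enorm (grad f (x k))) (fun=> sqrtr_ge0 _) lim_neq0.
pose c := eta * (1 - eta / 2).
(* This is where [eta < 2] enters. *)
have c0 : 0 < c by rewrite mulr_gt0 //; lra.
have descent k : 0 < L (x k) (rt k) /\
    c * enorm (grad f (x k)) ^+ 2 / L (x k) (rt k) <= f (x k) - f (x k.+1).
  have [rk0 Lk0 rtE ->] := GD k.
  have [? h] := LFSO_descent _ _ _ _ _ _ _ _ LF eta0 rk0 Lk0 rtE.
  by split=> //; rewrite lerBrDr -lerBrDl.
have f_noninc k : f (x k.+1) <= f (x k).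
  have [Lk0 /(le_trans _)h] := descent k; rewrite -subr_ge0 h //.
  exact: divr_ge0 (mulr_ge0 (ltW c0) (sqr_ge0 _)) (ltW Lk0).
have df0 := nonincreasing_increment_cvg0 _ (f \o x) fstar f_noninc
  (fun n => f_ge (x n)).
apply/cvgryPgt => A.
(* Raising the threshold to at least 1 makes it positive, so that inequalities can be inverted. *)
pose B := Num.max A 1.
have B0 : 0 < B by rewrite lt_max ltr01 orbT.
have ce0 : 0 < c * e ^+ 2 := mulr_gt0 c0 (exprn_gt0 2 e0).
have bound0 : 0 < c * e ^+ 2 / B by rewrite divr_gt0.
near=> k.
have [Lk0 dk] := descent k.
apply: (@le_lt_trans _ _ B); first by rewrite le_max lexx.
(* It remains to show [c * e ^+ 2 / L (x k) (rt k) < c * e ^+ 2 / B]; the decrease of [f] at step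
   [k] separates the two sides. *)
rewrite -ltf_pV2 ?posrE // -(ltr_pM2l ce0).
apply: (@le_lt_trans _ _ (f (x k) - f (x k.+1))).
  apply: le_trans dk; rewrite ler_pM2r ?invr_gt0 // ler_pM2l //.
  rewrite ler_pXn2r ?nnegrE ?sqrtr_ge0 ?(ltW e0) //.
  by near: k.
by near: k; apply: (cvgr_lt _ df0).
Unshelve. all: by end_near. Qed.
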